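(* Let $n$ be the length of the source string, $t$ a positive integer (the number of traces), $0<\delta<1$ and $\rho=1-\delta$. Then $$L_{0,\mathrm{avg}}(n)\le L_{t,\mathrm{avg}}(\delta,n)\le L_{0,\mathrm{avg}}(n)+t\rho\cdot n.$$
   Context: For $x\in\{0,1\}^n$ and $0<\delta<1$, the deletion channel $\mathrm{Del}_\delta(x)$ is the distribution over $\{0,1\}^{\le n}$ obtained by independently deleting each bit of $x$ with probability $\delta$ and concatenating the surviving bits; a draw is a trace of $x$. $|\mathsf{LCS}(u,v)|$ denotes the length of a longest common subsequence of $u,v$. Define $L_{0,\mathrm{avg}}(n):=\max_{z\in\{0,1\}^n}\mathbb{E}_{x\sim\{0,1\}^n}[|\mathsf{LCS}(x,z)|]$ with $x$ uniform, and for $t\ge1$, $L_{t,\mathrm{avg}}(\delta,n):=\max_A\mathbb{E}_{x\sim\{0,1\}^n}\mathbb{E}_{y^{(1)},\dots,y^{(t)}\sim\mathrm{Del}_\delta(x)}[|\mathsf{LCS}(A(y^{(1)},\dots,y^{(t)},n),x)|]$, where $x$ is uniform, the $t$ traces are independent, and the maximum is over all algorithms $A$ that receive $n,\delta$ and the $t$ traces and output an $n$-bit string. *)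

(* Defs.v *)
From mathcomp Require Import all_boot all_order all_algebra.

Set Implicit Arguments.
Unset Strict Implicit.
Unset Printing Implicit Defensive.

Import Order.TTheory GRing.Theory Num.Theory.
Local Open Scope ring_scope.

(* Any subsequence of u has size at most size u, so it is enough to let s range
   over the finite type of sequences of size at most size u. *)
Definition lcs (u v : seq bool) : nat :=
  \max_(s : (size u).-bseq bool | subseq s u && subseq s v) size s.

(* p is meant to be a probability mass function on T. *)
Definition expect (R : realFieldType) (T : finType) (p f : T -> R) : R :=
  \sum_(a : T) p a * f a.

Definition unif (R : realFieldType) (T : finType) : T -> R :=
  fun _ => #|T|%:R^-1.

Definition iid (R : realFieldType) (T : finType) (t : nat) (p : T -> R) :
    t.-tuple T -> R :=
  fun a => \prod_(i < t) p (tnth a i).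

(* m is the pattern of surviving positions: m_i = true, i.e., the i-th bit of x
   is kept, with probability 1 - delta, independently for each i. A trace y can
   arise from several patterns. *)
Definition del (R : realFieldType) (n : nat) (delta : R) (x : n.-tuple bool) :
    n.-bseq bool -> R :=
  fun y => \sum_(m : n.-tuple bool | mask m x == y)
             \prod_(i < n) (if tnth m i then 1 - delta else delta).

(* In the two maxima below, the index type is finite and nonempty and all the
   values are nonnegative, so the default value 0 is harmless. *)
Definition L0avg (R : realFieldType) (n : nat) : R :=
  \big[Num.max/0]_(z : n.-tuple bool)
     expect (@unif R {: n.-tuple bool}) (fun x => (lcs x z)%:R).

(* delta and n being fixed, an algorithm is a map from t traces to an n-bit
   string. *)
Definition Ltavg (R : realFieldType) (t : nat) (delta : R) (n : nat) : R :=
  \big[Num.max/0]_(A : {ffun t.-tuple (n.-bseq bool) -> n.-tuple bool})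
     expect (@unif R {: n.-tuple bool}) (fun x =>
       expect (iid (del delta x)) (fun y => (lcs (A y) x)%:R)).

(* Main.v *)
(** Reveal to the algorithm the deletion patterns of all traces.  Given the
    patterns, the traces depend only on the bits of [x] at the set [k] of the
    positions that survive in some trace.  Resample the other bits: if [a] and
    [b] are independent and uniform, the string equal to [a] on [k] and to [b]
    off [k] is uniform, it has the traces of [a], and it is at Hamming distance
    at most [#|k|] from [b], which is independent of the output of the
    algorithm.  The LCS is 1-Lipschitz for the Hamming distance, so the expected
    LCS is at most [L0avg + #|k|], and [#|k|] is at most the total length of the
    traces, of mean [t * (1 - delta) * n]. *)
Require Import Defs.
From mathcomp Require Import all_boot all_order all_algebra.
Import Order.TTheory GRing.Theory Num.Theory.
Local Open Scope ring_scope.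

Set Implicit Arguments.
Unset Strict Implicit.

(** * The LCS is 1-Lipschitz for the Hamming distance *)

Lemma lcs_max {u v s : seq bool} :
  subseq s u -> subseq s v -> (size s <= lcs u v)%N.
Proof.
move=> su sv; pose s' : (size u).-bseq bool := Bseq (size_subseq su).
have P : subseq s' u && subseq s' v by rewrite /= su.
exact: (@leq_bigmax_cond _ (fun s : (size u).-bseq bool => subseq s u && subseq s v)
  (fun s => size s) s' P).
Qed.

Lemma lcs_le (u v : seq bool) (k : nat) :
  (forall s, subseq s u -> subseq s v -> (size s <= k)%N) -> (lcs u v <= k)%N.
Proof. by move=> le_k; apply/bigmax_leqP => s /andP[]; apply: le_k. Qed.

Lemma lcsC (u v : seq bool) : lcs u v = lcs v u.
Proof. by apply/eqP; rewrite eqn_leq !lcs_le // => s su sv; apply: lcs_max. Qed.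

(** Match [s] greedily into [u] and drop the letters that fall on a position where [u] and [v]
    differ; each dropped letter is paid for by its own mismatch. *)
Lemma subseq_hamming (s u v : seq bool) : size u = size v -> subseq s u ->
  exists2 s', subseq s' s && subseq s' v &
    (size s <= size s' + \sum_(p <- zip u v) (p.1 != p.2))%N.
Proof.
elim: u v s => [|a u IHu] [|b v] s //=.
  by move=> _ /eqP->; exists [::]; rewrite ?big_nil.
move=> [/IHu{}IHu]; case: s => [|c s] /=; first by exists [::].
rewrite big_cons /=; have [<-|neq_ca] := eqVneq c a => su.
  have [s' /andP[s's s'v] le_s] := IHu _ su.
  have [<-|neq_cb] := eqVneq c b; first by exists (c :: s') => //=; rewrite eqxx s's s'v.
  exists s'; last by rewrite addnCA add1n ltnS.
  by apply/andP; split; [exact: subseq_trans s's (subseq_cons _ c)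
                       | exact: subseq_trans s'v (subseq_cons _ b)].
have [s' /andP[s's s'v] le_s] := IHu _ su.
exists s'; first by apply/andP; split=> //; exact: subseq_trans s'v (subseq_cons _ b).
by rewrite addnCA (leq_trans le_s) ?leq_addl.
Qed.

Lemma lcs_hamming (n : nat) (z : seq bool) (x y : n.-tuple bool) :
  (lcs z x <= lcs z y + \sum_(i < n) (tnth x i != tnth y i))%N.
Proof.
have -> : (\sum_(i < n) (tnth x i != tnth y i) =
           \sum_(p <- zip x y) (p.1 != p.2))%N.
  rewrite -[zip x y]/(tval (zip_tuple x y)) big_tuple.
  apply: eq_bigr => i _.
  by rewrite (tnth_nth (false, false)) nth_zip ?size_tuple //= -!tnth_nth.
apply: lcs_le => s sz sx.
have [|s' /andP[s's s'y] le_s] := @subseq_hamming s x y _ sx.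
  by rewrite !size_tuple.
by rewrite (leq_trans le_s) // leq_add2r (lcs_max (subseq_trans s's sz) s'y).
Qed.

Lemma eq_mask_tuple (T : Type) (n : nat) (m : n.-tuple bool) (x y : n.-tuple T) :
  (forall i, tnth m i -> tnth x i = tnth y i) -> mask m x = mask m y.
Proof.
(* Both masks become images of the same list of kept indices, on which [tnth x] and [tnth y]
   agree. *)
move=> eq_xy; rewrite -(map_tnth_enum x) -(map_tnth_enum y).
rewrite -(map_mask (tnth x)) -(map_mask (tnth y)).
apply/eq_in_map => i; rewrite in_mask ?enum_uniq // mem_enum index_enum_ord /=.
by rewrite -tnth_nth; apply: eq_xy.
Qed.

(** * Finite expectations and product measures *)

Section Expectation.
Context {R : realFieldType}.

Lemma le_expect (T : finType) (p f g : T -> R) :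
  (forall a, 0 <= p a) -> (forall a, f a <= g a) -> expect p f <= expect p g.
Proof. by move=> p0 fg; apply: ler_sum => a _; apply: ler_wpM2l. Qed.

Lemma expectD (T : finType) (p f g : T -> R) :
  expect p (fun a => f a + g a) = expect p f + expect p g.
Proof. by rewrite -big_split; apply: eq_bigr => a _; rewrite mulrDr. Qed.

Lemma expect_sum (T I : finType) (p : T -> R) (f : I -> T -> R) :
  expect p (fun a => \sum_i f i a) = \sum_i expect p (f i).
Proof. by rewrite exchange_big; apply: eq_bigr => a _; rewrite mulr_sumr. Qed.

Lemma expect_const (T : finType) (p : T -> R) (c : R) :
  \sum_a p a = 1 -> expect p (fun=> c) = c.
Proof. by move=> p1; rewrite /expect -mulr_suml p1 mul1r. Qed.

Lemma expectC (S T : finType) (p : S -> R) (q : T -> R) (f : S -> T -> R) :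
  expect p (fun a => expect q (f a)) = expect q (fun b => expect p (f^~ b)).
Proof.
rewrite /expect; under eq_bigr do rewrite mulr_sumr.
rewrite exchange_big; apply: eq_bigr => b _; rewrite mulr_sumr.
by apply: eq_bigr => a _; rewrite mulrCA.
Qed.

Lemma unif_ge0 (T : finType) (a : T) : 0 <= unif R a.
Proof. by rewrite invr_ge0 ler0n. Qed.

Lemma sum_unif (T : finType) : (0 < #|T|)%N -> \sum_(a : T) unif R a = 1.
Proof.
move=> T0; rewrite sumr_const -[LHS]mulr_natr mulVf //.
by rewrite pnatr_eq0 -lt0n.
Qed.

(** The factor may vary with the index, which allows weighting a single coordinate or constraining
    each coordinate separately. *)
Lemma sum_tuple_prod (T : finType) (t : nat) (F : 'I_t -> T -> R) :
  \sum_(a : t.-tuple T) \prod_(i < t) F i (tnth a i) =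
  \prod_(i < t) \sum_(b : T) F i b.
Proof.
rewrite bigA_distr_bigA (reindex (fun f : {ffun 'I_t -> T} => [tuple f i | i < t])).
  by apply: eq_bigr => f _; apply: eq_bigr => i _; rewrite tnth_mktuple.
exists (fun a : t.-tuple T => [ffun i => tnth a i]) => a _.
  by apply/ffunP => i; rewrite ffunE tnth_mktuple.
by apply: eq_from_tnth => i; rewrite tnth_mktuple ffunE.
Qed.

Section Iid.
Variables (T : finType) (t : nat) (p : T -> R).
Hypotheses (p_ge0 : forall a, 0 <= p a) (sum_p : \sum_a p a = 1).

Lemma iid_ge0 (a : t.-tuple T) : 0 <= iid p a.
Proof. exact: prodr_ge0. Qed.

Lemma sum_iid : \sum_(a : t.-tuple T) iid p a = 1.
Proof. by rewrite (sum_tuple_prod (fun=> p)) big1. Qed.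

Lemma expect_iid_tnth (j : 'I_t) (g : T -> R) :
  expect (@iid R T t p) (fun a => g (tnth a j)) = expect p g.
Proof.
(* The weight [g] enters only the factor of index [j]; every other factor sums to 1. *)
pose F i b := p b * (if i == j then g b else 1).
transitivity (\sum_(a : t.-tuple T) \prod_(i < t) F i (tnth a i)).
  apply: eq_bigr => a _; rewrite big_split /=; congr (_ * _).
  by rewrite -big_mkcond big_pred1_eq.
rewrite (sum_tuple_prod F) (bigD1 j) //= [X in _ * X]big1 ?mulr1 => [|i /negPf ij].
  by apply: eq_bigr => b _; rewrite /F eqxx.
by rewrite -[RHS]sum_p; apply: eq_bigr => b _; rewrite /F ij mulr1.
Qed.

Lemma expect_iid_sum (g : T -> R) :
  expect (@iid R T t p) (fun a => \sum_(j < t) g (tnth a j)) =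
  t%:R * expect p g.
Proof.
rewrite expect_sum; under eq_bigr do rewrite expect_iid_tnth.
by rewrite sumr_const card_ord mulr_natl.
Qed.

End Iid.

(** The fiber of [map_tuple h] over [y] is the product of the fibers of [h] over the entries of
    [y]. *)
Lemma expect_iid_pushforward (S T : finType) (t : nat) (h : S -> T) (p : S -> R)
    (q : T -> R) (f : t.-tuple T -> R) :
  (forall b, q b = \sum_(s | h s == b) p s) ->
  expect (iid q) f = expect (@iid R S t p) (fun a => f (map_tuple h a)).
Proof.
move=> qE; rewrite /expect [RHS](partition_big (map_tuple h) xpredT) //=.
apply: eq_bigr => y _.
transitivity (\sum_(a : t.-tuple S | map_tuple h a == y) iid p a * f y); last first.
  by apply: eq_bigr => a /eqP->.
rewrite -mulr_suml; congr (_ * _).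
rewrite /iid; under eq_bigr do rewrite qE big_mkcond.
(* Each constraint is an indicator factor, so a tuple outside the fiber contributes a zero
   product. *)
rewrite -(sum_tuple_prod (fun i s => if h s == tnth y i then p s else 0)).
rewrite [RHS]big_mkcond; apply: eq_bigr => a _.
case: eqP => [<-|neq_y].
  by apply: eq_bigr => i _; rewrite tnth_map eqxx.
have [i /negPf neq_i] : exists i, h (tnth a i) != tnth y i.
  apply/existsP; rewrite -negb_forall; apply/negP => /forallP eq_y.
  by apply: neq_y; apply: eq_from_tnth => i; rewrite tnth_map (eqP (eq_y i)).
by rewrite (bigD1 i) //= neq_i mul0r.
Qed.

End Expectation.

(** * Resampling the bits outside a set of positions *)

Lemma sum_unif_bits (R : realFieldType) (n : nat) :
  \sum_(a : n.-tuple bool) unif R a = 1.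
Proof. by apply: sum_unif; rewrite card_tuple card_bool expn_gt0. Qed.

Definition splice (n : nat) (k a b : n.-tuple bool) : n.-tuple bool :=
  [tuple if tnth k i then tnth a i else tnth b i | i < n].

(* [(a, b) |-> (splice k a b, splice k b a)] is an involution. *)
Lemma expect_unif_splice (R : realFieldType) (n : nat) (k : n.-tuple bool)
    (f : n.-tuple bool -> R) :
  expect (@unif R (n.-tuple bool)) f =
  expect (@unif R (n.-tuple bool)) (fun a =>
    expect (@unif R (n.-tuple bool)) (fun b => f (splice k a b))).
Proof.
have sum1 := sum_unif_bits R n.
(* An idle variable [b] is added so that the involution can reindex a sum over pairs; the weights
   are constant and do not change. *)
transitivity (expect (@unif R (n.-tuple bool)) (fun a =>
    expect (@unif R (n.-tuple bool)) (fun b => f a))).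
  by apply: eq_bigr => a _; rewrite expect_const.
rewrite /expect; under eq_bigr do rewrite mulr_sumr.
under [RHS]eq_bigr do rewrite mulr_sumr.
rewrite !pair_big /=.
rewrite (reindex_inj (h := fun ab => (splice k ab.1 ab.2, splice k ab.2 ab.1))) //=.
apply: (@inv_inj _ (fun ab => (splice k ab.1 ab.2, splice k ab.2 ab.1))).
by case=> a b; congr pair; apply: eq_from_tnth => i /=;
  rewrite !tnth_mktuple; case: (tnth k i).
Qed.

(** * Deletion patterns and the traces they determine *)

Section Channel.
Context {R : realFieldType}.
Variables (n t : nat) (delta : R).
Hypotheses (hdelta0 : 0 < delta) (hdelta1 : delta < 1).

Definition keep (b : bool) : R := if b then 1 - delta else delta.
Definition pattern : n.-tuple bool -> R := iid keep.

Lemma keep_ge0 b : 0 <= keep b.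
Proof. by case: b; rewrite /keep ?subr_ge0 ltW. Qed.

Lemma sum_keep : \sum_b keep b = 1.
Proof. by rewrite big_bool /= subrK. Qed.

Lemma pattern_ge0 m : 0 <= pattern m.
Proof. exact/iid_ge0/keep_ge0. Qed.

Lemma sum_pattern : \sum_m pattern m = 1.
Proof. exact/sum_iid/sum_keep. Qed.

Lemma expect_pattern_size :
  expect pattern (fun m => \sum_(i < n) (tnth m i)%:R) = (1 - delta) * n%:R.
Proof.
rewrite (expect_iid_sum _ sum_keep (fun b => b%:R)) mulrC.
by rewrite /expect big_bool /= mulr1 mulr0 addr0.
Qed.

Lemma size_mask_tuple (m x : n.-tuple bool) : (size (mask m x) <= n)%N.
Proof.
by rewrite size_mask ?size_tuple // -[X in (_ <= X)%N](size_tuple m) count_size.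
Qed.

Definition trace (x m : n.-tuple bool) : n.-bseq bool := Bseq (size_mask_tuple m x).

Lemma expect_iid_del (x : n.-tuple bool) (f : t.-tuple (n.-bseq bool) -> R) :
  expect (@iid R _ t (del delta x)) f =
  expect (@iid R _ t pattern) (fun M => f (map_tuple (trace x) M)).
Proof. exact: expect_iid_pushforward. Qed.

Lemma expect_lcs_pattern (M : t.-tuple (n.-tuple bool))
    (A : t.-tuple (n.-bseq bool) -> n.-tuple bool) :
  expect (@unif R (n.-tuple bool))
    (fun x => (lcs (A (map_tuple (trace x) M)) x)%:R) <=
  L0avg R n + \sum_(j < t) \sum_(i < n) (tnth (tnth M j) i)%:R.
Proof.
pose k := [tuple [exists j, tnth (tnth M j) i] | i < n].
have sum1 := sum_unif_bits R n.
(* The bound is proved for each [a] separately, hence [L] is written as a constant expectation over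
   [a]. *)
set L := L0avg R n + _; rewrite (expect_unif_splice k) -[L](expect_const _ sum1).
apply: le_expect => [|a]; first exact: unif_ge0.
set y := map_tuple (trace a) M.
have traceE b : map_tuple (trace (splice k a b)) M = y.
  apply: eq_from_tnth => j; rewrite /y !tnth_map; apply: val_inj.
  apply: (eq_mask_tuple (x := splice k a b)) => i mi; rewrite !tnth_mktuple.
  by case: existsP => // -[]; exists j.
apply: (@le_trans _ _ (expect (@unif R (n.-tuple bool)) (fun b =>
    (lcs b (A y))%:R + \sum_(j < t) \sum_(i < n) (tnth (tnth M j) i)%:R))).
  apply: le_expect => [|b]; first exact: unif_ge0.
  rewrite traceE exchange_big.
  under eq_bigr do rewrite -natr_sum.
  rewrite -natr_sum -natrD ler_nat (leq_trans (lcs_hamming _ _ b)) // (lcsC b) leq_add2l.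
  (* A position in [k] is charged to one trace [j] in which it survives; off [k] the spliced string
     agrees with [b]. *)
  apply: leq_sum => i _; rewrite !tnth_mktuple.
  case: existsP => [[j mij]|_]; last by rewrite eqxx.
  by rewrite (bigD1 j) //= mij (leq_trans (leq_b1 _)) ?leq_addr.
(* As [a] is fixed, [A y] is a constant string and competes in the maximum [L0avg]. *)
rewrite expectD (expect_const _ sum1) lerD2r.
exact: (le_bigmax 0 (fun z : n.-tuple bool =>
  expect (@unif R _) (fun x : n.-tuple bool => (lcs x z)%:R))).
Qed.

End Channel.

Unset Implicit Arguments.

Theorem theorem5p1 (R : realFieldType) (n t : nat) (delta : R)
    (ht : (0 < t)%N) (hdelta0 : 0 < delta) (hdelta1 : delta < 1) :
  L0avg R n <= Ltavg t delta n /\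
  Ltavg t delta n <= L0avg R n + t%:R * (1 - delta) * n%:R.
Proof.
have pattern0 (m : n.-tuple bool) : 0 <= pattern delta m by apply: pattern_ge0.
have pattern1 := sum_pattern n delta.
have L0_ge0 : 0 <= L0avg R n by apply: bigmax_ge_id.
split.
  apply: bigmax_le => [|z _]; first exact: bigmax_ge_id.
  (* The algorithm that ignores the traces and outputs [z] attains exactly the value of [z]. *)
  apply: le_trans (le_bigmax _ _ [ffun=> z]); rewrite le_eqVlt; apply/orP; left.
  apply/eqP; apply: eq_bigr => x _; congr (_ * _).
  rewrite expect_iid_del; under [RHS]eq_bigr do rewrite ffunE.
  by rewrite lcsC -/(expect _ (fun=> _)) expect_const // sum_iid.
apply: bigmax_le => [|A _].
  by rewrite addr_ge0 // !mulr_ge0 ?ler0n // subr_ge0 ltW.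
(* The law of the traces depends on [x], but that of the patterns does not, so the two expectations
   can be exchanged. *)
have -> : expect (@unif R (n.-tuple bool)) (fun x =>
    expect (iid (del delta x)) (fun y => (lcs (A y) x)%:R)) =
  expect (@iid R _ t (pattern delta)) (fun M => expect (@unif R (n.-tuple bool))
    (fun x => (lcs (A (map_tuple (trace x) M)) x)%:R)).
  by rewrite -expectC; apply: eq_bigr => x _; rewrite expect_iid_del.
apply: le_trans (le_expect _ (fun M => expect_lcs_pattern M A)) _.
  exact: iid_ge0.
rewrite expectD (expect_const _ (sum_iid _ pattern1)) lerD2l.
rewrite (expect_iid_sum _ pattern1 (fun m => \sum_(i < n) (tnth m i)%:R)).
by rewrite expect_pattern_size mulrA.
Qed.
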